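(* Let $n\ge 3$, $K=\mathbb R^n_+$, $d\in\mathbb R^n$, and let $A=\operatorname{diag}(d)$ be a diagonal matrix. Let $b=(b_1,\dots,b_n)^\top\in\mathbb R^n$, $c\in\mathbb R$, and let $f:\mathbb S^n\cap\operatorname{int}(K)\to\mathbb R$ be defined by $f(x)=\langle Ax,x\rangle+\langle b,x\rangle+c$. If $$b_i\le 2\left[\min(d_1,\dots,d_n)-d_i\right]$$ for all $i\in[n]$, then $f$ is spherically convex.
   Context: $\langle x,y\rangle=x^\top y$ is the canonical inner product on $\mathbb R^n$, $\|\cdot\|$ the Euclidean norm, $\mathbb S^n=\{x\in\mathbb R^n:\|x\|=1\}$, $[n]=\{1,\dots,n\}$, $\mathbb R^n_+$ is the nonnegative orthant. $\operatorname{diag}(d)$ is the diagonal matrix with diagonal entries $d_1,\dots,d_n$. Geodesics of $\mathbb S^n$ are great circles (intersections of $\mathbb S^n$ with two-dimensional subspaces); a minimal geodesic segment is a shortest great-circle arc joining two points, parametrized proportionally to arc length. A function $f:\mathbb S^n\cap\operatorname{int}(K)\to\mathbb R$ is spherically convex if for every minimal geodesic segment $\gamma:J\to\mathbb S^n\cap\operatorname{int}(K)$ ($J$ an interval), the composition $f\circ\gamma$ is convex on $J$. *)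

(* Defs.v *)
From mathcomp Require Export all_boot all_order all_algebra.
From mathcomp Require Export all_classical all_reals all_analysis.
Export Order.TTheory GRing.Theory Num.Theory.
Export numFieldNormedType.Exports.

Set Implicit Arguments.
Unset Strict Implicit.
Unset Printing Implicit Defensive.

Local Open Scope classical_set_scope.
Local Open Scope ring_scope.

Definition dot (R : realType) (n : nat) (x y : 'cV[R]_n) : R :=
  (x^T *m y) 0 0.

(* The library norm on matrices is the sup norm, hence this definition. *)
Definition eucl_norm (R : realType) (n : nat) (x : 'cV[R]_n) : R :=
  Num.sqrt (dot x x).

Definition sphere (R : realType) (n : nat) : set 'cV[R]_n :=
  [set x | eucl_norm x = 1].

Definition orthant (R : realType) (n : nat) : set 'cV[R]_n :=
  [set x | forall i, 0 <= x i 0].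

Definition great_circle (R : realType) (n : nat) (G : set 'cV[R]_n) : Prop :=
  exists2 W : {vspace 'cV[R]_n},
    \dim W = 2%N & G = @sphere R n `&` [set x | x \in W].

(* [u] and [v] are orthogonal points of the great circle [G], so
   [s |-> cos s *: u + sin s *: v] runs along [G] by arc length; [gam] has
   constant speed [w], and its arc over [s, t] has length [w * (t - s)].
   Only the values of [gam] on [J] matter. *)
Definition great_circle_arc (R : realType) (n : nat) (J : set R)
    (gam : R -> 'cV[R]_n) (w : R) : Prop :=
  0 <= w /\
  exists (G : set 'cV[R]_n) (u v : 'cV[R]_n),
    [/\ great_circle G, G u, G v, dot u v = 0 &
        forall t, J t -> gam t = cos (w * t) *: u + sin (w * t) *: v].

(* Since [J] need not be compact, minimality is required of every compact
   sub-arc: no great-circle arc with the same end points is shorter. *)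
Definition minimal_geodesic (R : realType) (n : nat) (J : set R)
    (gam : R -> 'cV[R]_n) : Prop :=
  is_interval J /\
  exists w : R, great_circle_arc J gam w /\
    forall s t, J s -> J t -> s <= t ->
    forall (a b : R) (del : R -> 'cV[R]_n) (w' : R),
      a <= b -> great_circle_arc `[a, b] del w' ->
      del a = gam s -> del b = gam t ->
      w * (t - s) <= w' * (b - a).

(* [f] stands for a function on [C]: its values off [C] play no role. *)
Definition spherically_convex (R : realType) (n : nat) (C : set 'cV[R]_n)
    (f : 'cV[R]_n -> R) : Prop :=
  forall (J : set R) (gam : R -> 'cV[R]_n),
    minimal_geodesic J gam -> (forall t, J t -> C (gam t)) ->
    convex_function (E := R^o) J (f \o gam).

(* The minimum over all indices; the seed [d i0 0] is itself one of the
   entries, so the value does not depend on [i0]. *)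
Definition min_entry (R : realType) (n : nat) (d : 'cV[R]_n) (i0 : 'I_n) : R :=
  \big[Num.min/d i0 0]_(j < n) d j 0.

(* Main.v *)
Require Import Defs.
From mathcomp Require Import ring lra.

(** Put [m := min_j d_j] and [e_i := d_i - m >= 0].  On the sphere the sum of
    the squared coordinates is 1, so that
      [f x = m + c + \sum_i (e_i * x_i ^+ 2 + b_i * x_i)],
    and the hypothesis reads [b_i <= - 2 * e_i]; it therefore suffices to treat
    each coordinate separately.  Along a great-circle arc of speed [w] a
    coordinate is a harmonic function [h] of time, [h'' = - w ^+ 2 * h], hence
    it is concave as long as the arc stays in the orthant, where [h >= 0]
    ([harmonic_concave]).  The one-variable function
    [x |-> e_i * x ^+ 2 + b_i * x] is convex, and the bound on [b_i] makes it
    nonincreasing on [0, 1], where the coordinates of a point of the sphere in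
    the orthant lie.  A convex nonincreasing function of a concave function is
    convex ([quadratic_of_concave]). *)

Set Implicit Arguments.
Unset Strict Implicit.
Unset Printing Implicit Defensive.

Local Open Scope classical_set_scope.
Local Open Scope ring_scope.

Lemma is_interval_chord (R : realType) (J : set R) (l : {i01 R}) (s t : R) :
  is_interval J -> J s -> J t -> J (l%:num * s + (1 - l%:num) * t).
Proof.
move=> itvJ Js Jt.
have l0 : 0 <= l%:num by [].
have l1 : l%:num <= 1 by [].
by have [st|ts] := leP s t; [apply: (itvJ s t)|apply: (itvJ t s)] => //;
  apply/andP; split; nra.
Qed.

Definition harmonic (R : realType) (w p q t : R) : R :=
  p * cos (w * t) + q * sin (w * t).

Lemma is_derive_harmonic (R : realType) (w u v t : R) :
  is_derive t 1 (harmonic w u v) (harmonic w (w * v) (- (w * u)) t).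
Proof.
have dlin : is_derive t (1 : R) (fun s : R => w * s) w.
  apply: (is_derive_eq (is_deriveZ w (is_derive_id t 1))).
  by rewrite /GRing.scale /= mulr1.
have dcos := is_derive1_comp (is_derive_cos (w * t)) dlin.
have dsin := is_derive1_comp (is_derive_sin (w * t)) dlin.
apply: (is_derive_eq (is_deriveD (is_deriveZ u dcos) (is_deriveZ v dsin))).
by rewrite /GRing.scale /= /harmonic; ring.
Qed.

Lemma derive_harmonic (R : realType) (w u v : R) :
  'D_1 (harmonic w u v) = harmonic w (w * v) (- (w * u)).
Proof.
apply/funext => t.
exact: (@derive_val _ _ _ _ _ _ _ (is_derive_harmonic _ _ _ t)).
Qed.

(** The second derivative of a harmonic function of frequency [w] is
    [- w ^+ 2] times itself, so its sign decides concavity. *)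
Lemma harmonic_concave (R : realType) (w p q : R) (J : set R) (l : {i01 R})
    (s t : R) :
  is_interval J -> J s -> J t ->
  (forall r, J r -> 0 <= harmonic w p q r) ->
  l%:num * harmonic w p q s + (1 - l%:num) * harmonic w p q t
    <= harmonic w p q (l%:num * s + (1 - l%:num) * t).
Proof.
move=> itvJ Js Jt h_ge0.
wlog st : l s t Js Jt / s <= t => [wlog_st|].
  have [|/ltW ts] := leP s t; first exact: wlog_st.
  have := wlog_st (1 - l%:num)%:i01 t s Jt Js ts.
  rewrite /= subKr addrC [X in _ <= harmonic w p q X]addrC; exact.
have cont r : {for r, continuous (harmonic w (- p) (- q))}.
  apply/differentiable_continuous/derivable1_diffP.
  by exact: (@ex_derive _ _ _ _ _ _ _ (is_derive_harmonic w (- p) (- q) r)).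
have Nharm r : harmonic w (- p) (- q) r = - harmonic w p q r.
  by rewrite /harmonic; ring.
suff : harmonic w (- p) (- q) (l%:num * s + (1 - l%:num) * t)
    <= l%:num * harmonic w (- p) (- q) s
       + (1 - l%:num) * harmonic w (- p) (- q) t.
  by rewrite !Nharm !mulrN -opprD lerN2.
apply: (@second_derivative_convex _ (harmonic w (- p) (- q)) s t) => //.
- move=> r /andP[/ltW sr /ltW rt]; rewrite derive_harmonic.
  have Jr : J r by apply: (itvJ s t) => //; rewrite sr rt.
  rewrite [leRHS](_ : _ = w ^+ 2 * harmonic w p q r).
    by rewrite mulr_ge0 ?sqr_ge0 ?h_ge0.
  rewrite (@derive_val _ _ _ _ _ _ _ (is_derive_harmonic _ _ _ r)) /harmonic.
  ring.
- exact/cvg_at_left_filter/cont.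
- exact/cvg_at_right_filter/cont.
- by move=> r _; rewrite derive_harmonic;
    case: (is_derive_harmonic w (w * - q) (- (w * - p)) r).
Qed.

(** The bound [b <= - 2 * e] makes the derivative [2 * e * x + b] of the convex
    function [x |-> e * x ^+ 2 + b * x] nonpositive for [x <= 1], so lowering
    the value [z] of a concave function to that of its chord can only increase
    the result. *)
Lemma quadratic_of_concave (R : realType) (e b l x y z : R) :
  0 <= e -> b <= - (2 * e) -> 0 <= l -> l <= 1 ->
  x <= 1 -> y <= 1 -> z <= 1 -> l * x + (1 - l) * y <= z ->
  e * z ^+ 2 + b * z
    <= l * (e * x ^+ 2 + b * x) + (1 - l) * (e * y ^+ 2 + b * y).
Proof.
move=> e0 be l0 l1 x1 y1 z1 chord_le.
set u := l * x + (1 - l) * y in chord_le.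
have u1 : u <= 1 by apply: le_trans z1.
have antitone : e * z ^+ 2 + b * z <= e * u ^+ 2 + b * u.
  have : 0 <= (z - u) * (- b - e * (z + u)).
    apply: mulr_ge0; first lra.
    have : 0 <= e * (2 - (z + u)) by apply: mulr_ge0 => //; lra.
    lra.
  lra.
apply: le_trans antitone _.
have : 0 <= e * (l * (1 - l) * (x - y) ^+ 2).
  by rewrite mulr_ge0 // mulr_ge0 ?sqr_ge0 // mulr_ge0 ?subr_ge0.
rewrite /u; lra.
Qed.

Section Coordinates.
Variables (R : realType) (n : nat).
Implicit Types (x d b : 'cV[R]_n).

Lemma dotE x y : dot x y = \sum_i x i 0 * y i 0.
Proof. by rewrite /dot mxE; apply: eq_bigr => i _; rewrite mxE. Qed.

Lemma sphere_sum_sqr x : sphere x -> \sum_i x i 0 ^+ 2 = 1.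
Proof.
rewrite /sphere /= /eucl_norm dotE => norm1.
under eq_bigr do rewrite expr2.
have sum_ge0 : 0 <= \sum_i x i 0 * x i 0.
  by apply: sumr_ge0 => i _; rewrite -expr2 sqr_ge0.
by rewrite -(sqr_sqrtr sum_ge0) norm1 expr1n.
Qed.

Lemma sphere_coord_le1 x i : sphere x -> x i 0 <= 1.
Proof.
move=> /sphere_sum_sqr; rewrite (bigD1 i) //= => sum1.
have rest_ge0 : 0 <= \sum_(j | j != i) x j 0 ^+ 2.
  by apply: sumr_ge0 => j _; rewrite sqr_ge0.
have : x i 0 ^+ 2 <= 1 by rewrite -sum1 lerDl.
nra.
Qed.

Lemma min_entry_le d i j : min_entry d i <= d j 0.
Proof. exact: bigmin_le. Qed.

Lemma min_entry_seed d i j : min_entry d i = min_entry d j.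
Proof.
by apply/eqP; rewrite eq_le; apply/andP; split;
  apply/bigmin_geP; split => [|k _]; exact: min_entry_le.
Qed.

(** On the sphere a multiple of the identity contributes a constant to the
    quadratic form, so the diagonal may be shifted by any [m]. *)
Lemma diag_quadratic_on_sphere d b c m x : sphere x ->
  dot (diag_mx d^T *m x) x + dot b x + c
    = \sum_i ((d i 0 - m) * x i 0 ^+ 2 + b i 0 * x i 0) + (m + c).
Proof.
move=> /sphere_sum_sqr sum1; rewrite !dotE big_split /=.
under eq_bigr do rewrite mul_diag_mx !mxE.
under [in RHS]eq_bigr do rewrite mulrBl.
rewrite sumrB -mulr_sumr sum1 mulr1.
under eq_bigr do rewrite -mulrA -expr2.
ring.
Qed.

End Coordinates.

Theorem corollary3 (R : realType) (n : nat) (d b : 'cV[R]_n) (c : R) :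
  (3 <= n)%N ->
  (forall i : 'I_n, b i 0 <= 2 * (min_entry d i - d i 0)) ->
  spherically_convex (@sphere R n `&` (@orthant R n)°)
    (fun x : 'cV[R]_n => dot (diag_mx d^T *m x) x + dot b x + c).
Proof.
move=> n_ge3 b_le J gam [itvJ [w [[_ [G [u [v [_ _ _ _ gamE]]]]] _]]] gamC l.
move=> s t; rewrite !inE => Js Jt.
set r : R := l%:num * s + (1 - l%:num) * t; rewrite /comp /= -[conv l s t]/r.
have Jr : J r by apply: is_interval_chord.
have gam_sphere k : J k -> sphere (gam k) by move=> /gamC[].
have gam_ge0 k i : J k -> 0 <= gam k i 0.
  by move=> /gamC[_ /interior_subset]; apply.
have gam_coord k i : J k -> gam k i 0 = harmonic w (u i 0) (v i 0) k.
  by move=> /gamE ->; rewrite /harmonic !mxE mulrC [X in _ + X]mulrC.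
pose i0 := Ordinal (ltn_trans (isT : (0 < 2)%N) n_ge3).
pose m := min_entry d i0.
have convE (x y : R) :
  conv l (x : R^o) (y : R^o) = l%:num * x + (1 - l%:num) * y by [].
rewrite /= convE !(diag_quadratic_on_sphere d b c m) //; try exact: gam_sphere.
have conv_addr (x y k : R) : l%:num * (x + k) + (1 - l%:num) * (y + k)
    = l%:num * x + (1 - l%:num) * y + k by ring.
rewrite conv_addr lerD2r !mulr_sumr -big_split /=; apply: ler_sum => i _.
apply: quadratic_of_concave; try exact/sphere_coord_le1/gam_sphere; rewrite //.
- by rewrite subr_ge0 min_entry_le.
- by apply: le_trans (b_le i) _; rewrite (min_entry_seed d i i0) -/m; lra.
- rewrite !gam_coord //; apply: (harmonic_concave (J := J)) => // k Jk.
  by rewrite -gam_coord // gam_ge0.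
Qed.
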